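(* Let $\mathcal{E}_0$ be the class of two-qubit states, $S_L$ the normalized linear entropy, $C$ the concurrence, and ''VBI'' the property of violating Bell–CHSH inequalities, all as defined in the context, and let $$\Lambda_{\mathcal{E}_0}=\{(S_L(\rho),C(\rho)) : \rho\in\mathcal{E}_0,\ C(\rho)>0\}\subset\mathbb{R}^2 .$$ For $0<c\le 1$ put $$S_{\max}(c)=\begin{cases}\frac{8}{9}-\frac{2}{3}c^2, & c<\frac{2}{3},\\[1mm] \frac{8}{3}c(1-c), & c\ge \frac{2}{3},\end{cases}\qquad S_1(c)=\frac{2}{3}c^2,\qquad S_2(c)=\frac{2-c^2+2\sqrt{1-c^2}}{6},$$ and define $$\Lambda_1=\{(s,c): 0<c\le \tfrac{1}{\sqrt2},\ 0\le s<S_1(c)\}\cup\{(s,c): \tfrac{1}{\sqrt2}<c\le 1,\ 0\le s\le S_{\max}(c)\},$$ $$\Lambda_2=\{(s,c): 0<c\le \tfrac{1}{\sqrt2},\ S_1(c)\le s<S_2(c)\},$$ $$\Lambda_3=\{(s,c): 0<c\le \tfrac{1}{\sqrt2},\ S_2(c)\le s\le S_{\max}(c)\}.$$ Then $\Lambda_{\mathcal{E}_0}$ is the union of the pairwise disjoint sets $\Lambda_1,\Lambda_2,\Lambda_3$, and: 1. If $(s,c)\in\Lambda_1$, then every state $\rho\in\mathcal{E}_0$ with $S_L(\rho)=s$ and $C(\rho)=c$ is VBI. 2. If $(s,c)\in\Lambda_2$, then there exist states $\rho_1,\rho_2\in\mathcal{E}_0$ with $S_L(\rho_1)=S_L(\rho_2)=s$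 and $C(\rho_1)=C(\rho_2)=c$ such that $\rho_1$ is VBI but $\rho_2$ is not VBI. 3. If $(s,c)\in\Lambda_3$, then every state $\rho\in\mathcal{E}_0$ with $S_L(\rho)=s$ and $C(\rho)=c$ is not VBI.
   Context: A two-qubit state is a $4\times4$ complex matrix $\rho\ge 0$ with $\mathrm{tr}\,\rho=1$, acting on $\mathbb{C}^2\otimes\mathbb{C}^2=\mathbb{C}^4$ with the standard product basis ordered as $e_1\otimes e_1,\ e_1\otimes e_2,\ e_2\otimes e_1,\ e_2\otimes e_2$. $\mathcal{E}_0$ is the set of all two-qubit states of the form $$\rho=\begin{pmatrix}0&0&0&0\\0&\rho_{22}&\rho_{23}&0\\0&\rho_{32}&\rho_{33}&0\\0&0&0&\rho_{44}\end{pmatrix}.$$ Let $\sigma_1,\sigma_2,\sigma_3$ be the Pauli matrices. The concurrence of a two-qubit state $\rho$ is $$C(\rho)=\max\bigl(0,\ 2p_{\max}(\widehat\rho)-\mathrm{tr}\,\widehat\rho\bigr),\qquad \widehat\rho=(\rho^{1/2}\rho^{\dagger}\rho^{1/2})^{1/2},\qquad \rho^{\dagger}=(\sigma_2\otimes\sigma_2)\,\overline{\rho}\,(\sigma_2\otimes\sigma_2),$$ where $p_{\max}(\widehat\rho)$ is the largest eigenvalue of $\widehat\rho$, $\overline{\rho}$ is the entrywise complex conjugate, and $\rho^\dagger$ denotes the matrix just defined (not the adjoint). The normalized linear entropy is $S_L(\rho)=\frac{4}{3}(1-\mathrm{tr}\,\rho^2)$. For unit vectors $a,a',b,b'\in\mathbb{R}^3$,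 writing $v\cdot\sigma=\sum_{j=1}^3 v_j\sigma_j$, let $$B_{CHSH}=a\cdot\sigma\otimes(b+b')\cdot\sigma+a'\cdot\sigma\otimes(b-b')\cdot\sigma .$$ A state $\rho$ is said to be VBI (violates Bell inequalities) if there is a choice of unit vectors $a,a',b,b'\in\mathbb{R}^3$ for which the inequality $|\mathrm{tr}(\rho B_{CHSH})|\le 2$ fails; otherwise $\rho$ is not VBI. *)

(* Defs.v *)
From HB Require Import structures.
From mathcomp Require Import all_boot all_order all_algebra.
From mathcomp Require Import classical_sets reals.
From mathcomp Require Import complex mxtens.

Set Implicit Arguments.
Unset Strict Implicit.
Unset Printing Implicit Defensive.

Import Order.TTheory GRing.Theory Num.Theory.
Local Open Scope ring_scope.
Local Open Scope sesquilinear_scope.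
Local Open Scope classical_set_scope.

(* Two-qubit matrices have type 'M[R[i]]_(2 * 2), the type of A *t B for 2 x 2
   matrices A and B.  Indices 0, 1, 2, 3 stand for e1 (x) e1, e1 (x) e2,
   e2 (x) e1, e2 (x) e2 (see mxtens_index). *)

Definition psd (R : realType) n (A : 'M[R[i]]_n) : Prop :=
  A \is hermsymmx /\ forall v : 'rV[R[i]]_n, 0 <= (v *m A *m v^t*) 0 0.

(* A normal matrix A equals U^-1 *m diag_mx (spectral_diag A) *m U with
   U = spectralmx A unitary, so for A psd this is the psd square root A^(1/2).
   The value has no meaning when A is not psd. *)
Definition sqrtmx (R : realType) n (A : 'M[R[i]]_n) : 'M[R[i]]_n :=
  invmx (spectralmx A) *m diag_mx (map_mx sqrtC (spectral_diag A))
    *m spectralmx A.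

(* The largest (real) eigenvalue; for a Hermitian matrix of positive size the
   set is finite and nonempty, so that the supremum is a maximum. *)
Definition pmax (R : realType) n (A : 'M[R[i]]_n) : R :=
  sup [set x : R | eigenvalue A (x%:C)%C].

Definition mx22 (T : Type) (a b c d : T) : 'M[T]_2 :=
  \matrix_(i < 2, j < 2)
    if i == 0 then (if j == 0 then a else b) else (if j == 0 then c else d).

Section TwoQubits.
Variable R : realType.
Implicit Types (rho : 'M[R[i]]_(2 * 2)) (v a b : 'rV[R]_3).

Definition sigma1 : 'M[R[i]]_2 := mx22 0 1 1 0.
Definition sigma2 : 'M[R[i]]_2 := mx22 0 (- 'i%C) 'i%C 0.
Definition sigma3 : 'M[R[i]]_2 := mx22 1 0 0 (- 1).

Definition sigma (j : 'I_3) : 'M[R[i]]_2 :=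
  nth 0 [:: sigma1; sigma2; sigma3] j.

Definition is_state rho : Prop := psd rho /\ \tr rho = 1.

Definition E0 : set 'M[R[i]]_(2 * 2) :=
  [set rho | is_state rho /\
    forall i j : 'I_(2 * 2),
      (val i, val j) \notin
        [:: (1, 1); (1, 2); (2, 1); (2, 2); (3, 3)]%N ->
      rho i j = 0].

Definition spin_flip rho : 'M[R[i]]_(2 * 2) :=
  (sigma2 *t sigma2) *m map_mx Num.conj rho *m (sigma2 *t sigma2).

Definition rho_hat rho : 'M[R[i]]_(2 * 2) :=
  sqrtmx (sqrtmx rho *m spin_flip rho *m sqrtmx rho).

(* The traces below are real for a state; complex.Re only changes their type. *)
Definition concurrence rho : R :=
  Num.max 0 (2 * pmax (rho_hat rho) - complex.Re (\tr (rho_hat rho))).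

Definition linear_entropy rho : R :=
  4 / 3 * (1 - complex.Re (\tr (rho *m rho))).

(* The canonical norm on 'rV[R]_3 in the analysis library is the sup norm, hence
   the explicit Euclidean norm. *)
Definition unit_vector v : Prop := Num.sqrt (\sum_(j < 3) v 0 j ^+ 2) = 1.

Definition dot_sigma v : 'M[R[i]]_2 := \sum_(j < 3) (v 0 j)%:C%C *: sigma j.

Definition B_CHSH a a' b b' : 'M[R[i]]_(2 * 2) :=
  dot_sigma a *t dot_sigma (b + b') + dot_sigma a' *t dot_sigma (b - b').

Definition VBI rho : Prop :=
  exists a a' b b' : 'rV[R]_3,
    [/\ unit_vector a, unit_vector a', unit_vector b & unit_vector b'] /\
    ~ (`|\tr (rho *m B_CHSH a a' b b')| <= 2).

Definition S_max (c : R) : R :=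
  if c < 2 / 3 then 8 / 9 - 2 / 3 * c ^+ 2 else 8 / 3 * c * (1 - c).

Definition S_1 (c : R) : R := 2 / 3 * c ^+ 2.

Definition S_2 (c : R) : R := (2 - c ^+ 2 + 2 * Num.sqrt (1 - c ^+ 2)) / 6.

Definition Lambda_E0 : set (R * R) :=
  [set (linear_entropy rho, concurrence rho)
    | rho in [set rho | E0 rho /\ 0 < concurrence rho]].

Definition Lambda1 : set (R * R) :=
  [set p | let: (s, c) := p in
    0 < c <= (Num.sqrt 2)^-1 /\ 0 <= s < S_1 c] `|`
  [set p | let: (s, c) := p in
    (Num.sqrt 2)^-1 < c <= 1 /\ 0 <= s <= S_max c].

Definition Lambda2 : set (R * R) :=
  [set p | let: (s, c) := p in
    0 < c <= (Num.sqrt 2)^-1 /\ S_1 c <= s < S_2 c].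

Definition Lambda3 : set (R * R) :=
  [set p | let: (s, c) := p in
    0 < c <= (Num.sqrt 2)^-1 /\ S_2 c <= s <= S_max c].

End TwoQubits.

Arguments E0 : clear implicits.
Arguments Lambda_E0 : clear implicits.
Arguments Lambda1 : clear implicits.
Arguments Lambda2 : clear implicits.
Arguments Lambda3 : clear implicits.

(* Main.v *)
Require Import Defs.
From mathcomp Require Import all_boot all_order all_algebra.
From mathcomp Require Import classical_sets reals.
From mathcomp Require Import complex mxtens.
From mathcomp Require Import ring lra.

(* A state in E_0 is given by p = rho_22, q = rho_33, r = rho_44 and
   z = x + iy = rho_23.  The eigenvalues of rho rho^dagger are
   (sqrt (pq) +- |z|)^2, 0, 0, whence C = 2|z|; its correlation matrix has singular
   values C, C, |2r - 1|, so by Horodecki's argument rho is VBI iff 2C^2 > 1 or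
   C^2 + (2r - 1)^2 > 1.  For fixed C and r the entropy is an increasing function
   of pq, which ranges over [C^2/4, (1-r)^2/4].  For 2C^2 <= 1 violation amounts to
   r < r0 with 4 r0 (1 - r0) = C^2, and S_1, S_2 are the two extreme entropies at
   r = r0. *)

Set Implicit Arguments.
Unset Strict Implicit.
Unset Printing Implicit Defensive.

Import Order.TTheory GRing.Theory Num.Theory.
Local Open Scope ring_scope.
Local Open Scope sesquilinear_scope.
Local Open Scope classical_set_scope.

(** * Characteristic polynomials and spectral square roots *)

Lemma char_poly_mulC (F : idomainType) n (A B : 'M[F]_n) :
  char_poly (A *m B) = char_poly (B *m A).
Proof.
pose A' := map_mx polyC A; pose B' := map_mx polyC B.
(* [M] links the two products: clearing its lower left block from the right gives
   [\det M = char_poly (A *m B)], clearing it from the left gives the same for [B *m A] up to a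
   factor ['X^n] on both sides, which cancels. *)
pose M := block_mx 'X%:M A' B' 1%:M.
have detM : \det M = char_poly (A *m B).
  have : M *m block_mx 1%:M 0 (- B') 1%:M
      = block_mx (char_poly_mx (A *m B)) A' 0 1%:M.
    rewrite mulmx_block !mulmx1 !mul1mx !mulmx0 !add0r mulmxN subrr.
    by rewrite /char_poly_mx map_mxM.
  by move/(congr1 determinant); rewrite det_mulmx det_lblock det_ublock !det1 !mulr1.
have : block_mx 1%:M 0 (- B') 'X%:M *m M
    = block_mx 'X%:M A' 0 (char_poly_mx (B *m A)).
  rewrite mulmx_block !mulmx1 !mul1mx !mul0mx !addr0 mulNmx mul_mx_scalar.
  by rewrite mul_scalar_mx addNr mulNmx /char_poly_mx map_mxM addrC.
move/(congr1 determinant); rewrite det_mulmx det_lblock det_ublock det1 mul1r detM.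
rewrite det_scalar; apply: mulfI.
by rewrite expf_neq0 // polyX_eq0.
Qed.

Lemma char_poly_diag_mx (F : comNzRingType) n (d : 'rV[F]_n) :
  char_poly (diag_mx d) = \prod_(i < n) ('X - (d 0 i)%:P).
Proof.
rewrite char_poly_trig ?diag_mx_is_trig //.
by apply: eq_bigr => i _; rewrite mxE eqxx mulr1n.
Qed.

Lemma char_poly_similar (F : fieldType) n (P A : 'M[F]_n) :
  P \in unitmx -> char_poly (invmx P *m A *m P) = char_poly A.
Proof. by move=> Pu; rewrite char_poly_mulC mulmxA mulmxV // mul1mx. Qed.

(* Stated over an abstract closed field because unification over R[i] unfolds
   the complex operations and becomes prohibitively slow. *)
Section SpectralSqrt.
Variables (C : numClosedFieldType) (n : nat).
Implicit Types A B : 'M[C]_n.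

Local Notation sqrtm A := (invmx (spectralmx A)
  *m diag_mx (map_mx sqrtC (spectral_diag A)) *m spectralmx A).
Local Notation psdm A := (A \is hermsymmx /\
  forall v : 'rV[C]_n, 0 <= (v *m A *m v^t*) 0 0).

Lemma spectral_sqrtK A : A \is normalmx -> sqrtm A *m sqrtm A = A.
Proof.
move/orthomx_spectralP; have := spectral_unit A.
move: (spectralmx A) (spectral_diag A) => U d Uu eA.
rewrite [RHS]eA !mulmxA mulmxK // -[_ *m _ *m diag_mx _]mulmxA mulmx_diag.
congr (_ *m diag_mx _ *m _); apply/rowP => j.
by rewrite !mxE -expr2 sqrtCK.
Qed.

Lemma hermsymmxE A : (A \is hermsymmx) = (A == A ^t*).
Proof. by rewrite qualifE /= expr0 scale1r. Qed.

(** The quadratic form at row [i] of the unitary [spectralmx A] takes the [i]-th eigenvalue as its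
    value. *)
Lemma spectral_diag_ge0 A i : psdm A -> 0 <= spectral_diag A 0 i.
Proof.
case=> /hermitian_normalmx/orthomx_spectralP eA posA.
set U := spectralmx A in eA; set d := spectral_diag A in eA *.
have Uu : U \is unitarymx by exact: spectral_unitarymx.
have := posA (row i U); rewrite rowE [in X in 0 <= X]eA.
rewrite !mulmxA mulmxK ?spectral_unit // -!mulmxA.
rewrite trmx_mul map_mxM /= [U *m _]mulmxA (unitarymxP Uu) mul1mx.
rewrite mulmxA -rowE mxE (bigD1 i) //= big1 ?addr0; last first.
  by move=> j ji; rewrite !mxE eqxx (negPf ji) conjC0 mulr0.
by rewrite !mxE !eqxx conjC1 mulr1 mulr1n.
Qed.

Lemma spectral_sqrt_herm A : psdm A -> sqrtm A \is hermsymmx.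
Proof.
move=> psdA; rewrite hermsymmxE.
have := fun i => spectral_diag_ge0 i psdA.
have := invmx_unitary (spectral_unitarymx A).
move: (spectralmx A) (spectral_diag A) => U d -> d0.
rewrite !trmx_mul !map_mxM /= trmxCK mulmxA tr_diag_mx map_diag_mx.
apply/eqP; congr (_ *m diag_mx _ *m _); apply/rowP => j; rewrite !mxE.
by apply/esym/CrealP/ger0_real; rewrite sqrtC_ge0.
Qed.

(** By unique factorization any list of roots is a permutation of [spectral_diag A], so no explicit
    diagonalization is required. *)
Lemma spectral_sqrt_spectrum A (s : seq C) :
  A \is normalmx -> char_poly A = \prod_(z <- s) ('X - z%:P) ->
  char_poly (sqrtm A) = \prod_(z <- map sqrtC s) ('X - z%:P) /\
  \tr (sqrtm A) = \sum_(z <- map sqrtC s) z.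
Proof.
move/orthomx_spectralP; have := spectral_unit A.
move: (spectralmx A) (spectral_diag A) => U d Uu eA.
rewrite {1}eA !char_poly_similar // !char_poly_diag_mx.
rewrite -(big_map (d 0) xpredT (fun z => 'X - z%:P)).
move/prod_XsubC_eq/(perm_map sqrtC) => es.
rewrite -!(perm_big _ es) /= !big_map; split.
  by apply: eq_bigr => i _; rewrite mxE.
rewrite mxtrace_mulC mulmxA mulmxV // mul1mx mxtrace_diag.
by apply: eq_bigr => i _; rewrite mxE.
Qed.

Lemma herm_conjmx A B :
  A \is hermsymmx -> B \is hermsymmx -> A *m B *m A \is hermsymmx.
Proof.
rewrite !hermsymmxE => /eqP hA /eqP hB.
by rewrite !trmx_mul !map_mxM /= -hA -hB mulmxA.
Qed.

(** Cyclicity gives [M] the characteristic polynomial of [A *m B], so the square root of [A] is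
    never computed. *)
Lemma spectral_sqrt_conj_spectrum A B (s : seq C) :
  psdm A -> B \is hermsymmx -> char_poly (A *m B) = \prod_(z <- s) ('X - z%:P) ->
  let M := sqrtm A *m B *m sqrtm A in
  char_poly (sqrtm M) = \prod_(z <- map sqrtC s) ('X - z%:P) /\
  \tr (sqrtm M) = \sum_(z <- map sqrtC s) z.
Proof.
move=> psdA hB chi M; have nA : A \is normalmx.
  by apply: hermitian_normalmx; case: psdA.
apply: spectral_sqrt_spectrum.
  by apply/hermitian_normalmx/herm_conjmx => //; exact: spectral_sqrt_herm.
by rewrite char_poly_mulC mulmxA spectral_sqrtK.
Qed.

End SpectralSqrt.

(** * Concurrence from the spectrum of rho rho^dagger *)

Section Concurrence.
Variable R : realType.
Implicit Types rho : 'M[R[i]]_(2 * 2).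

(** The eigenvalues of [rho_hat rho] are l, m, 0, 0, and 2 l - (l + m) = l - m. *)
Lemma concurrence_spectrum rho (l m : R) :
  psd rho -> spin_flip rho \is hermsymmx -> 0 <= m <= l ->
  char_poly (rho *m spin_flip rho) =
    \prod_(z <- [:: (l ^+ 2)%:C; (m ^+ 2)%:C; 0; 0]%C) ('X - z%:P) ->
  concurrence rho = Num.max 0 (l - m).
Proof.
move=> psd_rho hflip /andP[m0 ml] chi.
have [chi_hat tr_hat] := spectral_sqrt_conj_spectrum psd_rho hflip chi.
rewrite -[X in char_poly X]/(rho_hat rho) in chi_hat.
rewrite -[X in \tr X]/(rho_hat rho) in tr_hat.
have sqK (t : R) : 0 <= t -> sqrtC ((t ^+ 2)%:C)%C = (t%:C)%C.
  by move=> t0; rewrite rmorphXn /= sqrCK // ler0c.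
have l0 := le_trans m0 ml.
rewrite /concurrence tr_hat.
have -> : pmax (rho_hat rho) = l.
  have eigE (t : R) : eigenvalue (rho_hat rho) (t%:C)%C = (t \in [:: l; m; 0; 0]).
    rewrite eigenvalue_root_char chi_hat root_prod_XsubC /= !sqK // sqrtC0.
    by rewrite !inE -!(inj_eq (@complexI R)).
  apply/eqP; rewrite eq_le; apply/andP; split.
    apply: ge_sup; first by exists l; rewrite /= eigE inE eqxx.
    by move=> t /=; rewrite eigE !inE => /or4P[] /eqP ->.
  apply: ub_le_sup; last by rewrite /= eigE inE eqxx.
  by exists l => t /=; rewrite eigE !inE => /or4P[] /eqP ->.
rewrite /= !sqK // sqrtC0 !big_cons big_nil /= !addr0.
by congr (Num.max _ _); ring.
Qed.

End Concurrence.

(** * Explicit 4 x 4 matrices with a central 2 x 2 block *)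

Section BlockMatrices.
Variable F : comNzRingType.

Definition mx4 (s : seq (seq F)) : 'M[F]_(2 * 2) :=
  \matrix_(i, j) nth 0 (nth [::] s i) j.

(** The corner [a] is 0 on E_0, but the spin flip exchanges it with [r]. *)
Definition bmx (a p z w q r : F) : 'M[F]_(2 * 2) :=
  mx4 [:: [:: a; 0; 0; 0]; [:: 0; p; z; 0]; [:: 0; w; q; 0]; [:: 0; 0; 0; r]].

(** With explicit ordinals, destructing [i] and [j] leaves sixteen entries that compute. *)
Lemma mx4P (A B : 'M[F]_(2 * 2)) :
  (forall i j (hi : (i < 4)%N) (hj : (j < 4)%N),
     A (Ordinal hi) (Ordinal hj) = B (Ordinal hi) (Ordinal hj)) -> A = B.
Proof. by move=> AB; apply/matrixP => -[i hi] [j hj]; exact: AB. Qed.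

Lemma tens_mx22 (a b c d a' b' c' d' : F) :
  mx22 a b c d *t mx22 a' b' c' d' =
  mx4 [:: [:: a * a'; a * b'; b * a'; b * b']; [:: a * c'; a * d'; b * c'; b * d'];
          [:: c * a'; c * b'; d * a'; d * b']; [:: c * c'; c * d'; d * c'; d * d']].
Proof.
by apply/mx4P => -[|[|[|[|i]]]] [|[|[|[|j]]]] hi hj //; rewrite !mxE.
Qed.

Lemma mulmx_bmx a p z w q r a' p' z' w' q' r' :
  bmx a p z w q r *m bmx a' p' z' w' q' r' =
  bmx (a * a') (p * p' + z * w') (p * z' + z * q')
      (w * p' + q * w') (w * z' + q * q') (r * r').
Proof.
apply/mx4P => -[|[|[|[|i]]]] [|[|[|[|j]]]] hi hj //;
  rewrite !mxE !big_ord_recl big_ord0 !mxE /=; ring.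
Qed.

Lemma mxtrace_bmx a p z w q r : \tr (bmx a p z w q r) = a + p + q + r.
Proof. by rewrite /mxtrace !big_ord_recl big_ord0 !mxE /=; ring. Qed.

Lemma mxtrace_bmx_tens p z w q r (a b c d a' b' c' d' : F) :
  \tr (bmx 0 p z w q r *m (mx22 a b c d *t mx22 a' b' c' d')) =
  p * (a * d') + z * (c * b') + w * (b * c') + q * (d * a') + r * (d * d').
Proof.
rewrite tens_mx22 /mxtrace !big_ord_recl big_ord0 !mxE.
by rewrite !big_ord_recl !big_ord0 !mxE /=; ring.
Qed.

Lemma form_bmx a p z w q r (v u : 'I_(2 * 2) -> F) :
  ((\row_j v j) *m bmx a p z w q r *m (\row_j u j)^T) 0 0 =
  a * (v (inord 0) * u (inord 0)) + p * (v (inord 1) * u (inord 1))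
  + z * (v (inord 1) * u (inord 2)) + w * (v (inord 2) * u (inord 1))
  + q * (v (inord 2) * u (inord 2)) + r * (v (inord 3) * u (inord 3)).
Proof.
rewrite !mxE !big_ord_recl big_ord0 !mxE !big_ord_recl !big_ord0 !mxE /=.
set o1 := lift ord0 ord0; set o2 := lift ord0 (lift _ _); set o3 := lift ord0 (lift _ _).
have -> : inord 0 = ord0 :> 'I_(2 * 2) by apply: val_inj; rewrite /= inordK.
have -> : inord 1 = o1 :> 'I_(2 * 2) by apply: val_inj; rewrite /= inordK.
have -> : inord 2 = o2 :> 'I_(2 * 2) by apply: val_inj; rewrite /= inordK.
have -> : inord 3 = o3 :> 'I_(2 * 2) by apply: val_inj; rewrite /= inordK.
ring.
Qed.

(** [J] is [sigma2 *t sigma2]: it reverses the basis, and its signs cancel because the outer and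
    inner basis vectors are not coupled. *)
Lemma flip_bmx a p z w q r :
  let J := mx4 [:: [:: 0; 0; 0; -1]; [:: 0; 0; 1; 0];
                   [:: 0; 1; 0; 0]; [:: -1; 0; 0; 0]] in
  J *m bmx a p z w q r *m J = bmx r q w z p a.
Proof.
move=> J; have -> : J *m bmx a p z w q r =
    mx4 [:: [:: 0; 0; 0; - r]; [:: 0; w; q; 0]; [:: 0; p; z; 0]; [:: - a; 0; 0; 0]].
  apply/mx4P => -[|[|[|[|i]]]] [|[|[|[|j]]]] hi hj //;
    rewrite !mxE !big_ord_recl big_ord0 !mxE /=; ring.
apply/mx4P => -[|[|[|[|i]]]] [|[|[|[|j]]]] hi hj //;
  rewrite !mxE !big_ord_recl big_ord0 !mxE /=; ring.
Qed.

Lemma char_poly_bmx a p z w q r :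
  char_poly (bmx a p z w q r) =
  ('X - a%:P) * ('X - r%:P) * (('X - p%:P) * ('X - q%:P) - (z * w)%:P).
Proof.
rewrite /char_poly; do 3!
  rewrite ?(expand_det_row _ ord0) /cofactor ?big_ord_recl ?big_ord0 ?mxE /=
    ?(mulr0n, subrr, mul0r, addr0, add0r).
rewrite ?det_mx11 ?mxE /= ?polyCM; ring.
Qed.

End BlockMatrices.

(** * Real parameters for E_0; entropy and concurrence in these parameters *)

Section XStates.
Variable R : realType.
Local Open Scope complex_scope.
Implicit Types (p q r x y : R) (rho : 'M[R[i]]_(2 * 2)).

Definition xstate p q r x y : 'M[R[i]]_(2 * 2) :=
  bmx 0 p%:C (x +i* y) (x -i* y) q%:C r%:C.

(** These are exactly the conditions for [xstate] to be a state; the last one is the determinant of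
    the central block. *)
Definition xdata p q r x y :=
  [/\ 0 <= p, 0 <= q, 0 <= r, p + q + r = 1 & x ^+ 2 + y ^+ 2 <= p * q].

Lemma bmx_herm a p q r x y :
  bmx a%:C p%:C (x +i* y) (x -i* y) q%:C r%:C \is hermsymmx.
Proof.
rewrite hermsymmxE; apply/eqP/mx4P.
move=> -[|[|[|[|i]]]] [|[|[|[|j]]]] hi hj //;
  by rewrite !mxE /= ?conjC0 //; apply/eqP; rewrite eq_complex /= ?oppr0 ?opprK !eqxx.
Qed.

Lemma xstate_form p q r x y (v : 'rV[R[i]]_(2 * 2)) :
  let a i := complex.Re (v 0 (inord i)) in
  let b i := complex.Im (v 0 (inord i)) in
  (v *m xstate p q r x y *m v^t*) 0 0 =
  (p * (a 1 ^+ 2 + b 1 ^+ 2) + q * (a 2 ^+ 2 + b 2 ^+ 2)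
    + r * (a 3 ^+ 2 + b 3 ^+ 2)
    + 2 * (x * (a 1 * a 2 + b 1 * b 2) + y * (a 1 * b 2 - b 1 * a 2)))%:C.
Proof.
move=> a b.
have -> : v = \row_j v 0 j by apply/rowP => j; rewrite mxE.
rewrite -map_trmx; have -> : map_mx Num.conj (\row_j v 0 j) = \row_j Num.conj (v 0 j).
  by apply/rowP => j; rewrite !mxE.
rewrite form_bmx /a /b ?mxE.
case: (v 0 (inord 1)) (v 0 (inord 2)) (v 0 (inord 3)) => [a1 b1] [a2 b2] [a3 b3].
apply/eqP; rewrite eq_complex /=; simpc.
by move=> /=; apply/andP; split; apply/eqP; ring.
Qed.

Lemma xstate_form_ge0 p q x y a b c d :
  0 <= p -> 0 <= q -> x ^+ 2 + y ^+ 2 <= p * q ->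
  0 <= p * (a ^+ 2 + b ^+ 2) + q * (c ^+ 2 + d ^+ 2)
       + 2 * (x * (a * c + b * d) + y * (a * d - b * c)).
Proof.
rewrite le_eqVlt => /orP[/eqP <- q0|p0 q0 xy].
  (* For p = 0 no square can be completed, but then x = y = 0. *)
  rewrite mul0r => xy.
  have [-> ->] : x = 0 /\ y = 0 by split; nra.
  by rewrite !mul0r addr0 mulr0 addr0 add0r mulr_ge0 // addr_ge0 // sqr_ge0.
rewrite -(pmulr_rge0 _ p0).
(* complete the square in the first pair of variables *)
have -> : p * (p * (a ^+ 2 + b ^+ 2) + q * (c ^+ 2 + d ^+ 2)
       + 2 * (x * (a * c + b * d) + y * (a * d - b * c))) =
  (p * a + x * c + y * d) ^+ 2 + (p * b + x * d - y * c) ^+ 2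
  + (p * q - (x ^+ 2 + y ^+ 2)) * (c ^+ 2 + d ^+ 2) by ring.
by rewrite !addr_ge0 ?sqr_ge0 // mulr_ge0 ?subr_ge0 // addr_ge0 // sqr_ge0.
Qed.

Lemma xstate_E0 p q r x y : xdata p q r x y -> E0 R (xstate p q r x y).
Proof.
case=> p0 q0 r0 s1 xy; split; last first.
  by move=> -[[|[|[|[|i]]]] hi] [[|[|[|[|j]]]] hj] //= _; rewrite mxE.
split; last by rewrite mxtrace_bmx add0r -!rmorphD s1.
split=> [|v]; first exact: (bmx_herm 0).
rewrite xstate_form ler0c.
have r3 := mulr_ge0 r0 (addr_ge0 (sqr_ge0 (complex.Re (v 0 (inord 3))))
  (sqr_ge0 (complex.Im (v 0 (inord 3))))).
have := @xstate_form_ge0 p q x y (complex.Re (v 0 (inord 1)))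
  (complex.Im (v 0 (inord 1))) (complex.Re (v 0 (inord 2)))
  (complex.Im (v 0 (inord 2))) p0 q0 xy.
lra.
Qed.

Lemma E0_xstate rho :
  E0 R rho -> exists p q r x y, rho = xstate p q r x y /\ xdata p q r x y.
Proof.
case=> -[[herm pos] tr1] zeros.
have hE i j : rho i j = Num.conj (rho j i).
  by move: herm; rewrite hermsymmxE => /eqP {1}->; rewrite !mxE.
pose o k : 'I_(2 * 2) := inord k.
have oE k (hk : (k < 4)%N) : Ordinal hk = o k by apply: val_inj; rewrite /= inordK.
have realE i : rho i i = (complex.Re (rho i i))%:C.
  move: (hE i i); case: (rho i i) => a b /eqP; rewrite eq_complex /= eqxx /=.
  by move=> /eqP hb; congr Complex; lra.
exists (complex.Re (rho (o 1%N) (o 1%N))), (complex.Re (rho (o 2%N) (o 2%N))),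
  (complex.Re (rho (o 3%N) (o 3%N))), (complex.Re (rho (o 1%N) (o 2%N))),
  (complex.Im (rho (o 1%N) (o 2%N))).
set p := complex.Re _; set q := complex.Re _; set r := complex.Re _.
set x := complex.Re _; set y := complex.Im _.
have rhoE : rho = xstate p q r x y.
  apply: mx4P => -[|[|[|[|i]]]] [|[|[|[|j]]]] hi hj //;
    rewrite [RHS]mxE /=; try by apply: zeros.
  - by rewrite !oE realE.
  - by rewrite !oE /x /y; case: (rho _ _).
  - by rewrite !oE hE /x /y; case: (rho _ _).
  - by rewrite !oE realE.
  - by rewrite !oE realE.
split=> //; move: tr1 pos; rewrite rhoE mxtrace_bmx add0r -!rmorphD /=.
case=> s1 pos.
have form a b c d e : 0 <= p * (a ^+ 2 + b ^+ 2) + q * (c ^+ 2 + d ^+ 2)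
    + r * e ^+ 2 + 2 * (x * (a * c + b * d) + y * (a * d - b * c)).
  have := pos (\row_j nth 0 [:: 0; a +i* b; c +i* d; e%:C] j).
  by rewrite xstate_form ler0c !mxE !inordK //= expr0n addr0.
have p0 : 0 <= p by have := form 1 0 0 0 0; lra.
have q0 : 0 <= q by have := form 0 0 1 0 0; lra.
have r0 : 0 <= r by have := form 0 0 0 0 1; lra.
split=> //.
set N := x ^+ 2 + y ^+ 2.
have N0 : 0 <= N by rewrite addr_ge0 // sqr_ge0.
(* The test vector is (0, l, -(x + i y), 0). *)
have formN l : 0 <= p * l ^+ 2 + q * N - 2 * l * N.
  by have := form l 0 (- x) (- y) 0; rewrite /N; congr (_ <= _); ring.
move: q0; rewrite le_eqVlt => /orP[/eqP qE|q_gt0]; last first.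
  (* At l = q the form equals q (p q - N). *)
  by rewrite -(ler_pM2l q_gt0); have := formN q; lra.
(* For q = 0 and l = t the form equals -(p + 2) t^2, so t = 0; the added 1 keeps the denominator
   positive when p = 0. *)
set t := N / (p + 1); have Nt : N = t * (p + 1) by rewrite divfK // gt_eqF //; lra.
have := formN t; rewrite -qE mul0r addr0 mulr0 => form_t.
have pt := mulr_ge0 p0 (sqr_ge0 t).
have /eqP : t ^+ 2 = 0.
  apply/eqP; rewrite eq_le sqr_ge0 andbT; rewrite Nt in form_t; lra.
by rewrite sqrf_eq0 Nt => /eqP ->; rewrite mul0r.
Qed.

Lemma linear_entropy_xstate p q r x y :
  linear_entropy (xstate p q r x y) =
  4 / 3 * (1 - (p ^+ 2 + q ^+ 2 + r ^+ 2 + 2 * (x ^+ 2 + y ^+ 2))).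
Proof.
rewrite /linear_entropy mulmx_bmx mxtrace_bmx; congr (_ * (1 - _)); simpc => /=.
ring.
Qed.

(** Conjugation and the flip each exchange the off-diagonal entries of the central block, so these
    end up unchanged. *)
Lemma spin_flip_xstate p q r x y :
  spin_flip (xstate p q r x y) = bmx r%:C q%:C (x +i* y) (x -i* y) p%:C 0.
Proof.
rewrite /spin_flip.
have -> : sigma2 R *t sigma2 R = mx4 [:: [:: 0; 0; 0; -1]; [:: 0; 0; 1; 0];
    [:: 0; 1; 0; 0]; [:: -1; 0; 0; 0]].
  rewrite tens_mx22; apply: mx4P => -[|[|[|[|i]]]] [|[|[|[|j]]]] hi hj //;
  by rewrite !mxE /=; simpc.
have -> : map_mx Num.conj (xstate p q r x y) =
    bmx 0 p%:C (x -i* y) (x +i* y) q%:C r%:C.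
  apply: mx4P => -[|[|[|[|i]]]] [|[|[|[|j]]]] hi hj //;
  by rewrite !mxE /= ?conjC0 //; apply/eqP; rewrite eq_complex /= ?oppr0 ?opprK !eqxx.
exact: flip_bmx.
Qed.

Lemma concurrence_xstate p q r x y :
  xdata p q r x y ->
  concurrence (xstate p q r x y) = 2 * Num.sqrt (x ^+ 2 + y ^+ 2).
Proof.
move=> D; have [[psd_rho _] _] := xstate_E0 D.
case: D => p0 q0 _ _ xy; have pq0 := mulr_ge0 p0 q0.
set s := Num.sqrt (p * q); set w := Num.sqrt (x ^+ 2 + y ^+ 2).
have w0 : 0 <= w by exact: sqrtr_ge0.
have ws : w <= s by rewrite ler_wsqrtr.
have s2 : s ^+ 2 = p * q by rewrite sqr_sqrtr.
have w2 : w ^+ 2 = x ^+ 2 + y ^+ 2 by rewrite sqr_sqrtr // addr_ge0 // sqr_ge0.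
rewrite (@concurrence_spectrum _ _ (s + w) (s - w)) //.
- have -> : s + w - (s - w) = 2 * w by ring.
  by rewrite max_r // mulr_ge0.
- by rewrite spin_flip_xstate; exact: (bmx_herm _ _ _ 0).
- by lra.
rewrite spin_flip_xstate mulmx_bmx char_poly_bmx !big_cons big_nil.
have zz : (x +i* y) * (x -i* y) = (w%:C ^+ 2 : R[i]).
  rewrite -rmorphXn w2 /=; simpc; apply/eqP; rewrite eq_complex /=.
  by apply/andP; split; apply/eqP; ring.
have pq : p%:C * q%:C = (s%:C ^+ 2 : R[i]) by rewrite -rmorphXn s2 rmorphM.
(* The central block has both diagonal entries s^2 + w^2 and off-diagonal product 4 s^2 w^2, hence
   eigenvalues (s + w)^2 and (s - w)^2. *)
have -> : (p%:C * (x +i* y) + (x +i* y) * p%:C) * ((x -i* y) * q%:C + q%:C * (x -i* y))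
   = 4 * (p%:C * q%:C) * ((x +i* y) * (x -i* y)) :> R[i] by ring.
rewrite [(x -i* y) * _]mulrC [q%:C * p%:C]mulrC zz pq.
have -> : ((s + w) ^+ 2)%:C = (s%:C + w%:C) ^+ 2 by rewrite -rmorphD -rmorphXn.
have -> : ((s - w) ^+ 2)%:C = (s%:C - w%:C) ^+ 2 by rewrite -rmorphB -rmorphXn.
by rewrite !mul0r !(polyCM, polyCD, polyCN, polyC_exp, polyC0); ring.
Qed.

End XStates.

(** * The CHSH inequality as a statement about real vectors *)

Section RealCHSH.
Variable R : realType.

(* Writing (t, X, Y) = (r - p - q, 2x, 2y), this is the expectation of
   (a.sigma) (x) (u.sigma) in the state xstate p q r x y. *)
Definition corr (t X Y a0 a1 a2 u0 u1 u2 : R) :=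
  X * (a0 * u0 + a1 * u1) + Y * (a0 * u1 - a1 * u0) + t * (a2 * u2).

(** Cauchy-Schwarz for the unit vector a and the image (w0, w1, w2) of u under the correlation
    matrix, with the defect given by Lagrange's identity. *)
Lemma corr_sqr_le (t X Y a0 a1 a2 u0 u1 u2 : R) :
  a0 ^+ 2 + a1 ^+ 2 + a2 ^+ 2 = 1 ->
  corr t X Y a0 a1 a2 u0 u1 u2 ^+ 2 <=
  (X ^+ 2 + Y ^+ 2) * (u0 ^+ 2 + u1 ^+ 2) + t ^+ 2 * u2 ^+ 2.
Proof.
move=> a1E.
pose w0 := X * u0 + Y * u1; pose w1 := X * u1 - Y * u0; pose w2 := t * u2.
rewrite -subr_ge0.
have -> : (X ^+ 2 + Y ^+ 2) * (u0 ^+ 2 + u1 ^+ 2) + t ^+ 2 * u2 ^+ 2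
    - corr t X Y a0 a1 a2 u0 u1 u2 ^+ 2 =
    (a0 * w1 - a1 * w0) ^+ 2 + (a0 * w2 - a2 * w0) ^+ 2 + (a1 * w2 - a2 * w1) ^+ 2
    + (1 - (a0 ^+ 2 + a1 ^+ 2 + a2 ^+ 2)) * (w0 ^+ 2 + w1 ^+ 2 + w2 ^+ 2).
  by rewrite /corr /w0 /w1 /w2; ring.
by rewrite a1E subrr mul0r addr0 !addr_ge0 // sqr_ge0.
Qed.

(** Weighted Cauchy-Schwarz: (F + G)^2 <= (F^2 / U + G^2 / W) (U + W), where the first factor is at
    most 1. [U] and [W] will be the squared norms of b + b' and b - b'. *)
Lemma sqr_add_le4 (F G U W : R) :
  0 <= U -> 0 <= W -> U + W = 4 -> F ^+ 2 <= U -> G ^+ 2 <= W ->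
  F ^+ 2 * W + G ^+ 2 * U <= U * W -> (F + G) ^+ 2 <= 4.
Proof.
move=> U0 W0 UW4 FU GW FG.
have sq0 (z : R) : z ^+ 2 <= 0 -> z = 0.
  by move=> z0; apply/eqP; rewrite -sqrf_eq0 eq_le z0 sqr_ge0.
have [UE|U_neq0] := eqVneq U 0.
  by rewrite (sq0 F) ?add0r -?UE //; lra.
have [WE|W_neq0] := eqVneq W 0.
  by rewrite (sq0 G) ?addr0 -?WE //; lra.
have UW : 0 < U * W by rewrite mulr_gt0 // lt0r ?U_neq0 ?W_neq0.
rewrite -(ler_pM2l UW).
have -> : U * W * (F + G) ^+ 2 =
    (F ^+ 2 * W + G ^+ 2 * U) * (U + W) - (F * W - G * U) ^+ 2 by ring.
rewrite UW4; have := sqr_ge0 (F * W - G * U); lra.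
Qed.

(** [K] and [T] are the squared singular values; [Up], [Uz] and [Wp], [Wz] are the planar and axial
    parts of the squared norms of b + b' and b - b'. *)
Lemma sqr_add_le4_block (K T Up Uz Wp Wz F G : R) :
  [/\ 0 <= K, 0 <= T, 2 * K <= 1 & K + T <= 1] ->
  [/\ 0 <= Up, 0 <= Uz, 0 <= Wp & 0 <= Wz] ->
  Uz * Wz <= Up * Wp -> (Up + Uz) + (Wp + Wz) = 4 ->
  F ^+ 2 <= K * Up + T * Uz -> G ^+ 2 <= K * Wp + T * Wz ->
  (F + G) ^+ 2 <= 4.
Proof.
case=> K0 T0 K2 KT [Up0 Uz0 Wp0 Wz0] orth UW4 FE GE.
apply: (@sqr_add_le4 _ _ (Up + Uz) (Wp + Wz)) => //; try by lra.
- by apply: le_trans FE _; rewrite lerD //; apply: ler_piMl => //; lra.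
- by apply: le_trans GE _; rewrite lerD //; apply: ler_piMl => //; lra.
apply: (@le_trans _ _ ((K * Up + T * Uz) * (Wp + Wz) + (K * Wp + T * Wz) * (Up + Uz))).
  by rewrite lerD // ler_wpM2r // addr_ge0.
have h1 : 0 <= (1 - 2 * K) * (Up * Wp) by rewrite !mulr_ge0 // subr_ge0.
have h2 : 0 <= (1 - (K + T)) * (Up * Wz + Uz * Wp).
  by rewrite mulr_ge0 ?subr_ge0 // addr_ge0 // mulr_ge0.
(* If T > 1/2, the excess (2 T - 1) Uz Wz is absorbed by Up Wp: use [orth], and 2 T - 1 <= 1 - 2 K
   from K + T <= 1. *)
have h3 : 2 * T * (Uz * Wz) - Uz * Wz <= (1 - 2 * K) * (Up * Wp).
  have [T2|T2] := leP (2 * T) 1.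
    apply: le_trans h1; have : 0 <= (1 - 2 * T) * (Uz * Wz).
      by rewrite !mulr_ge0 // subr_ge0.
    lra.
  have : (2 * T - 1) * (Uz * Wz) <= (2 * T - 1) * (Up * Wp) by rewrite ler_wpM2l //; lra.
  have : (2 * T - 1) * (Up * Wp) <= (1 - 2 * K) * (Up * Wp).
    by rewrite ler_wpM2r ?mulr_ge0 //; lra.
  lra.
lra.
Qed.

Lemma chsh_sqr_le4 (t X Y a0 a1 a2 c0 c1 c2 b0 b1 b2 d0 d1 d2 : R) :
  a0 ^+ 2 + a1 ^+ 2 + a2 ^+ 2 = 1 -> c0 ^+ 2 + c1 ^+ 2 + c2 ^+ 2 = 1 ->
  b0 ^+ 2 + b1 ^+ 2 + b2 ^+ 2 = 1 -> d0 ^+ 2 + d1 ^+ 2 + d2 ^+ 2 = 1 ->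
  2 * (X ^+ 2 + Y ^+ 2) <= 1 -> X ^+ 2 + Y ^+ 2 + t ^+ 2 <= 1 ->
  (corr t X Y a0 a1 a2 (b0 + d0) (b1 + d1) (b2 + d2)
   + corr t X Y c0 c1 c2 (b0 - d0) (b1 - d1) (b2 - d2)) ^+ 2 <= 4.
Proof.
move=> aE cE bE dE K2 Kt.
apply: sqr_add_le4_block (corr_sqr_le t X Y _ _ _ aE) (corr_sqr_le t X Y _ _ _ cE).
- by split; rewrite ?addr_ge0 ?sqr_ge0.
- by split; rewrite ?addr_ge0 ?sqr_ge0.
- (* b + d and b - d are orthogonal: Cauchy-Schwarz in the (0, 1)-plane *)
  have e : (b0 + d0) * (b0 - d0) + (b1 + d1) * (b1 - d1) = - ((b2 + d2) * (b2 - d2)).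
    apply/eqP; rewrite -subr_eq0; apply/eqP.
    transitivity ((b0 ^+ 2 + b1 ^+ 2 + b2 ^+ 2) - (d0 ^+ 2 + d1 ^+ 2 + d2 ^+ 2)).
      by ring.
    by rewrite bE dE subrr.
  rewrite -subr_ge0 -exprMn -[((b2 + d2) * _) ^+ 2]sqrrN -e.
  set z := (X in 0 <= X).
  have -> : z = ((b0 + d0) * (b1 - d1) - (b1 + d1) * (b0 - d0)) ^+ 2 by rewrite /z; ring.
  exact: sqr_ge0.
(* Parallelogram law. *)
transitivity (2 * ((b0 ^+ 2 + b1 ^+ 2 + b2 ^+ 2) + (d0 ^+ 2 + d1 ^+ 2 + d2 ^+ 2))).
  by ring.
by rewrite bE dE; ring.
Qed.

Definition chsh_violation (t X Y : R) := exists a0 a1 a2 c0 c1 c2 b0 b1 b2 d0 d1 d2 : R,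
  [/\ a0 ^+ 2 + a1 ^+ 2 + a2 ^+ 2 = 1, c0 ^+ 2 + c1 ^+ 2 + c2 ^+ 2 = 1,
      b0 ^+ 2 + b1 ^+ 2 + b2 ^+ 2 = 1, d0 ^+ 2 + d1 ^+ 2 + d2 ^+ 2 = 1 &
      2 < `|corr t X Y a0 a1 a2 (b0 + d0) (b1 + d1) (b2 + d2)
            + corr t X Y c0 c1 c2 (b0 - d0) (b1 - d1) (b2 - d2)|].

(* Horodecki criterion: the singular values of the correlation matrix are
   c, c and |t|, where c^2 = X^2 + Y^2. *)
Lemma chsh_violationP (t X Y c : R) : 0 < c -> c ^+ 2 = X ^+ 2 + Y ^+ 2 ->
  chsh_violation t X Y <-> 1 < 2 * c ^+ 2 \/ 1 < c ^+ 2 + t ^+ 2.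
Proof.
move=> c0 cE; split.
  case=> [a0 [a1 [a2 [c0' [c1 [c2 [b0 [b1 [b2 [d0 [d1 [d2 []]]]]]]]]]]]].
  move=> aE c'E bE dE viol.
  have [|K2] := ltP 1 (2 * c ^+ 2); first by left.
  have [|Kt] := ltP 1 (c ^+ 2 + t ^+ 2); first by right.
  rewrite cE in K2 Kt.
  have := chsh_sqr_le4 aE c'E bE dE K2 Kt.
  rewrite -real_normK ?num_real //; move: viol; set z := `|_|; nra.
have c_neq0 : c != 0 by rewrite gt_eqF.
have cN : (X / c) ^+ 2 + (Y / c) ^+ 2 = 1.
  by rewrite !expr_div_n -mulrDl -cE divff // expf_neq0.
have ccE : X ^+ 2 / c + Y ^+ 2 / c = c by rewrite -mulrDl -cE expr2 mulfK.
case=> viol.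
  (* Here b + b' and b - b' have length 2 h along axes 0 and 1, and a, a' are aligned with the
     images of these axes; the value is 4 h c. *)
  pose h : R := Num.sqrt (1 / 2).
  have h0 : 0 < h by rewrite sqrtr_gt0; lra.
  have h2 : h ^+ 2 = 1 / 2 by rewrite sqr_sqrtr //; lra.
  exists (X / c), (- (Y / c)), 0, (Y / c), (X / c), 0, h, h, 0, h, (- h), 0.
  split; rewrite ?sqrrN ?expr0n /= ?addr0 ?h2 ?cN //; try lra.
  set v := (X in `|X|).
  have -> : v = 4 * h * (X ^+ 2 / c + Y ^+ 2 / c) by rewrite /v /corr; field.
  rewrite ccE ger0_norm; last by rewrite !mulr_ge0 ?ltW.
  rewrite -(@ltr_pXn2r _ 2) ?nnegrE ?mulr_ge0 ?ltW //.
  by rewrite !exprMn h2; lra.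
have D2_gt0 : 0 < c ^+ 2 + t ^+ 2 by lra.
(* Now b + b' and b - b' lie along axes 0 and 2 with lengths proportional to the singular values c
   and t; the value is 2 D. *)
pose D := Num.sqrt (c ^+ 2 + t ^+ 2).
have D_gt0 : 0 < D by rewrite sqrtr_gt0.
have D2 : D ^+ 2 = c ^+ 2 + t ^+ 2 by rewrite sqr_sqrtr // ltW.
have D_neq0 : D != 0 by rewrite gt_eqF.
have D1 : 1 < D by rewrite -(@ltr_pXn2r _ 2) ?nnegrE ?ltW // expr1n D2.
have DN : (c / D) ^+ 2 + (t / D) ^+ 2 = 1.
  by rewrite !expr_div_n -mulrDl -D2 divff // expf_neq0.
exists (X / c), (- (Y / c)), 0, 0, 0, 1, (c / D), 0, (t / D), (c / D), 0, (- (t / D)).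
split; rewrite ?sqrrN ?expr0n /= ?expr1n ?addr0 ?add0r //.
set v := (X in `|X|).
have -> : v = 2 / D * ((X ^+ 2 / c + Y ^+ 2 / c) * c + t ^+ 2).
  by rewrite /v /corr; field; rewrite c_neq0 D_neq0.
rewrite ccE -expr2 -D2 expr2 mulrA divfK // ger0_norm; lra.
Qed.

End RealCHSH.

(** * From Pauli matrices to real correlations *)

Section VBI.
Variable R : realType.
Local Open Scope complex_scope.
Implicit Types (v a b : 'rV[R]_3).

Lemma sum_ord3 (V : nmodType) (f : 'I_3 -> V) :
  \sum_(j < 3) f j = f (inord 0) + f (inord 1) + f (inord 2).
Proof.
rewrite !big_ord_recl big_ord0 addr0 addrA.
by congr (f _ + f _ + f _); apply: val_inj; rewrite /= inordK.
Qed.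

Lemma unit_vectorE v : unit_vector v <->
  v 0 (inord 0) ^+ 2 + v 0 (inord 1) ^+ 2 + v 0 (inord 2) ^+ 2 = 1.
Proof.
rewrite /unit_vector sum_ord3; set S := _ + _ + _.
have S0 : 0 <= S by rewrite !addr_ge0 ?sqr_ge0.
by split=> [S1|->]; rewrite ?sqrtr1 // -(sqr_sqrtr S0) S1 expr1n.
Qed.

Lemma dot_sigmaE v :
  let v0 := v 0 (inord 0) in let v1 := v 0 (inord 1) in let v2 := v 0 (inord 2) in
  dot_sigma v = mx22 v2%:C (v0 -i* v1) (v0 +i* v1) (- v2%:C).
Proof.
move=> v0 v1 v2; rewrite /dot_sigma sum_ord3 /sigma !inordK //=.
rewrite -/v0 -/v1 -/v2; apply/matrixP => -[[|[|i]] hi] [[|[|j]] hj] //;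
  rewrite !mxE /=; simpc; rewrite ?(mulr0, mulr1, addr0, add0r, subr0, sub0r, oppr0) //.
Qed.

Lemma mxtrace_xstate_tens (p q r x y : R) a u :
  \tr (xstate p q r x y *m (dot_sigma a *t dot_sigma u)) =
  (corr (r - p - q) (2 * x) (2 * y)
    (a 0 (inord 0)) (a 0 (inord 1)) (a 0 (inord 2))
    (u 0 (inord 0)) (u 0 (inord 1)) (u 0 (inord 2)))%:C.
Proof.
rewrite !dot_sigmaE mxtrace_bmx_tens /corr.
move: (a 0 _) (a 0 _) (a 0 _) (u 0 _) (u 0 _) (u 0 _) => a0 a1 a2 u0 u1 u2.
by simpc; apply/eqP; rewrite eq_complex /=; apply/andP; split; apply/eqP; ring.
Qed.

(** Brings the bound down to [R], where its negation is a strict inequality. *)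
Lemma normc_real_le2 (t : R) : (`|t%:C| <= 2 :> R[i]) = (`|t| <= 2).
Proof.
by rewrite normc_def /= expr0n addr0 sqrtr_sqr -lecR rmorph_nat.
Qed.

Lemma VBI_xstate (p q r x y : R) :
  VBI (xstate p q r x y) <-> chsh_violation (r - p - q) (2 * x) (2 * y).
Proof.
split.
  case=> [a [a' [b [b' [[ha ha' hb hb'] viol]]]]].
  move: ha ha' hb hb' => /unit_vectorE ha /unit_vectorE ha' /unit_vectorE hb /unit_vectorE hb'.
  do 12 eexists; split; [exact: ha|exact: ha'|exact: hb|exact: hb'|].
  move/negP: viol; rewrite /B_CHSH mulmxDr mxtraceD !mxtrace_xstate_tens.
  by rewrite -rmorphD normc_real_le2 -ltNge !mxE.
case=> [a0 [a1 [a2 [c0 [c1 [c2 [b0 [b1 [b2 [d0 [d1 [d2 [ha hc hb hd viol]]]]]]]]]]]]].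
pose vec (z0 z1 z2 : R) : 'rV[R]_3 := \row_j nth 0 [:: z0; z1; z2] j.
exists (vec a0 a1 a2), (vec c0 c1 c2), (vec b0 b1 b2), (vec d0 d1 d2).
split; first by split; apply/unit_vectorE; rewrite !mxE !inordK.
apply/negP; rewrite /B_CHSH mulmxDr mxtraceD !mxtrace_xstate_tens.
by rewrite -rmorphD normc_real_le2 -ltNge !mxE !inordK.
Qed.

End VBI.

(** * Entropy and concurrence at fixed rho_44 *)

Section Region.
Variable R : realType.
Implicit Types s c r p q x y : R.

(* The values of (S_L, C) reached with rho_44 = r: the two bounds on s correspond
   to the extreme values c^2/4 and (1-r)^2/4 of rho_22 * rho_33. *)
Definition region s c r :=
  [/\ 0 <= r, r <= 1 - c, 8 / 3 * (r * (1 - r)) <= s &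
      s <= 4 / 3 * (1 / 2 + r - 3 / 2 * r ^+ 2 - c ^+ 2 / 2)].

(** Horodecki's criterion, with r - p - q = 2 r - 1 by the trace condition. *)
Definition violating c r := 1 < 2 * c ^+ 2 \/ 1 < c ^+ 2 + (2 * r - 1) ^+ 2.

Lemma VBI_violating p q r x y c : 0 < c -> c ^+ 2 = 4 * (x ^+ 2 + y ^+ 2) ->
  p + q + r = 1 -> VBI (xstate p q r x y) <-> violating c r.
Proof.
move=> c0 cE s1.
have -> : VBI (xstate p q r x y) <-> chsh_violation (r - p - q) (2 * x) (2 * y).
  exact: VBI_xstate.
rewrite (@chsh_violationP _ _ _ _ c) //; last by rewrite cE; ring.
by have -> : r - p - q = 2 * r - 1 by lra.
Qed.

Lemma E0_region (rho : 'M[R[i]]_(2 * 2)) : E0 R rho -> 0 < concurrence rho ->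
  exists2 r, region (linear_entropy rho) (concurrence rho) r &
    VBI rho <-> violating (concurrence rho) r.
Proof.
move=> /E0_xstate[p [q [r [x [y [-> D]]]]]].
rewrite concurrence_xstate // linear_entropy_xstate.
set c := 2 * Num.sqrt _ => c0; exists r; case: D => p0 q0 r0 s1 xy; last first.
  apply: VBI_violating => //; rewrite exprMn sqr_sqrtr; first by ring.
  by rewrite addr_ge0 ?sqr_ge0.
have cE : c ^+ 2 = 4 * (x ^+ 2 + y ^+ 2).
  by rewrite exprMn sqr_sqrtr ?addr_ge0 ?sqr_ge0 //; ring.
have -> : x ^+ 2 + y ^+ 2 = c ^+ 2 / 4 by rewrite cE; field.
have {}xy : c ^+ 2 <= 4 * (p * q) by rewrite cE; lra.
have pE : p = 1 - r - q by lra.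
have pq := sqr_ge0 (p - q).
split=> //; last 2 first.
- by rewrite pE in xy *; lra.
- by rewrite pE in pq *; lra.
(* c^2 <= 4 p q <= (p + q)^2 = (1 - r)^2. *)
suff : c <= 1 - r by lra.
rewrite -(@ler_pXn2r _ 2) ?nnegrE ?(ltW c0) //; last lra.
by rewrite pE in pq xy; lra.
Qed.

Lemma region_E0 s c r : 0 < c -> region s c r ->
  exists rho : 'M[R[i]]_(2 * 2), [/\ E0 R rho, linear_entropy rho = s,
    concurrence rho = c & VBI rho <-> violating c r].
Proof.
move=> c0 [r0 rc sl su].
(* [m] is the product p q forced by [s]; p and q are then the roots of T^2 - (1 - r) T + m. *)
pose m := (3 / 4 * s - 2 * (r * (1 - r)) + c ^+ 2 / 2) / 2.
have m0 : c ^+ 2 / 4 <= m by rewrite /m; lra.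
have disc : 0 <= (1 - r) ^+ 2 - 4 * m by rewrite /m; lra.
pose h := Num.sqrt ((1 - r) ^+ 2 - 4 * m).
have h0 : 0 <= h by exact: sqrtr_ge0.
have h2 : h ^+ 2 = (1 - r) ^+ 2 - 4 * m by rewrite sqr_sqrtr.
have c2 := sqr_ge0 c.
have hr : h <= 1 - r by rewrite -(@ler_pXn2r _ 2) ?nnegrE //; lra.
have pq : (1 - r + h) / 2 * ((1 - r - h) / 2) = m.
  transitivity (((1 - r) ^+ 2 - h ^+ 2) / 4); first by field.
  by rewrite h2; field.
have D : xdata ((1 - r + h) / 2) ((1 - r - h) / 2) r (c / 2) 0.
  by split; try lra; rewrite pq expr0n /=; lra.
exists (xstate ((1 - r + h) / 2) ((1 - r - h) / 2) r (c / 2) 0); split.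
- exact: xstate_E0.
- rewrite linear_entropy_xstate.
  transitivity (4 / 3 * (1 - ((1 - r) ^+ 2 / 2 + h ^+ 2 / 2 + r ^+ 2 + c ^+ 2 / 2))).
    by field.
  by rewrite h2 /m; field.
- by rewrite concurrence_xstate // expr0n addr0 sqrtr_sqr ger0_norm; lra.
- by apply: VBI_violating => //; [field | lra].
Qed.

(** The upper bound on [s] is concave in [r] with vertex 1/3. The vertex is admissible up to c =
    2/3; beyond that the maximum is at r = 1 - c. Hence the two branches of [S_max]. *)
Lemma region_bounds s c r : 0 < c -> region s c r -> c <= 1 /\ 0 <= s <= S_max c.
Proof.
move=> c0 [r0 rc sl su]; split; first lra.
apply/andP; split.
  by apply: le_trans sl; rewrite !mulr_ge0 //; lra.
apply: le_trans su _; rewrite /S_max; case: ltP => c23.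
  by have := sqr_ge0 (r - 1 / 3); lra.
have : 0 <= (1 - c - r) * (1 - 3 / 2 * (1 - c + r)) by rewrite mulr_ge0 //; lra.
lra.
Qed.

Lemma region_fill s c : 0 < c <= 1 -> 0 <= s <= S_max c ->
  exists2 r, region s c r & 2 * c ^+ 2 <= 1 -> S_1 c <= s -> ~ violating c r.
Proof.
move=> /andP[c0 c1] /andP[s0 sm].
(* This [r] maximizes the upper bound on [s]. It serves as witness unless its lower bound exceeds
   [s]. *)
have [r [r0 rc r3 rm c_r]] : exists r, [/\ 0 <= r, r <= 1 - c, r <= 1 / 3,
    S_max c <= 4 / 3 * (1 / 2 + r - 3 / 2 * r ^+ 2 - c ^+ 2 / 2)
    & 2 * c ^+ 2 <= 1 -> c ^+ 2 <= 4 * (r * (1 - r))].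
  rewrite /S_max; case: ltP => c23.
    by exists (1 / 3); split; lra.
  by exists (1 - c); split; lra.
have [sr|rs] := leP (8 / 3 * (r * (1 - r))) s.
  exists r; first by split=> //; lra.
  by move=> c2 _; have := c_r c2; move=> {c_r} le_r [|]; lra.
have r49 := sqr_ge0 (r - 1 / 2).
(* Decrease [r] to the smaller root of 8/3 r (1 - r) = s, where the lower bound is tight; there
   [S_1 c <= s] says exactly that c^2 + (2 r - 1)^2 <= 1. *)
pose h := Num.sqrt (1 - 3 / 2 * s).
have h0 : 0 <= h by exact: sqrtr_ge0.
have h2 : h ^+ 2 = 1 - 3 / 2 * s by rewrite sqr_sqrtr //; lra.
have h1 : h <= 1 by rewrite -(@ler_pXn2r _ 2) ?nnegrE //; lra.
have hr : 1 - 2 * r <= h by rewrite -(@ler_pXn2r _ 2) ?nnegrE //; lra.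
have cr : 0 <= (1 - (1 - h) / 2 - c) * (1 - (1 - h) / 2 + c) by rewrite mulr_ge0 //; lra.
exists ((1 - h) / 2).
  by split; lra.
rewrite /violating /S_1 => c2 s1; have -> : 2 * ((1 - h) / 2) - 1 = - h by field.
by rewrite sqrrN h2; case; lra.
Qed.

Lemma half_sqr_boundsP c : 0 < c -> (c <= (Num.sqrt 2)^-1) = (2 * c ^+ 2 <= 1).
Proof.
move=> c0; have s2 : 0 < Num.sqrt 2 :> R by rewrite sqrtr_gt0.
have s2V : 0 <= (Num.sqrt 2 : R)^-1 by rewrite invr_ge0 ltW.
rewrite -(@ler_pXn2r _ 2) ?nnegrE ?(ltW c0) //.
by rewrite exprVn sqr_sqrtr // -[leRHS]mul1r ler_pdivlMr // mulrC.
Qed.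

(* [r0] is the smaller root of 4 r (1 - r) = c^2, where violation stops. *)
Lemma threshold c : 0 < c -> 2 * c ^+ 2 <= 1 -> exists r0,
  [/\ 0 < r0, r0 < 1 / 6, r0 <= 1 - c,
      4 * (r0 * (1 - r0)) = c ^+ 2 &
      S_2 c = 4 / 3 * (1 / 2 + r0 - 3 / 2 * r0 ^+ 2 - c ^+ 2 / 2)].
Proof.
move=> c0 c2; have cc : 0 < c ^+ 2 by rewrite exprn_gt0.
pose w := Num.sqrt (1 - c ^+ 2).
have w2 : w ^+ 2 = 1 - c ^+ 2 by rewrite sqr_sqrtr //; lra.
have w0 : 0 <= w by exact: sqrtr_ge0.
have w1 : w < 1 by rewrite -(@ltr_pXn2r _ 2) ?nnegrE //; lra.
have w23 : 2 / 3 < w.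
  rewrite -(@ltr_pXn2r _ 2) ?nnegrE //; last by lra.
  by rewrite w2; lra.
have cw : c <= w by rewrite -(@ler_pXn2r _ 2) ?nnegrE ?(ltW c0) //; lra.
exists ((1 - w) / 2); split; try lra.
by rewrite /S_2 -/w; lra.
Qed.

(** By the equation for [r0], S_2 - S_1 = 2/3 ((1 - r0)^2 - c^2) = 2/3 (1 - r0) (1 - 5 r0), which is
    positive as r0 < 1/6. *)
Lemma region_threshold c r0 : 0 < c -> 0 < r0 -> r0 < 1 / 6 -> r0 <= 1 - c ->
  4 * (r0 * (1 - r0)) = c ^+ 2 ->
  S_2 c = 4 / 3 * (1 / 2 + r0 - 3 / 2 * r0 ^+ 2 - c ^+ 2 / 2) ->
  region (S_2 c) c r0 /\ S_1 c < S_2 c.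
Proof.
by move=> c0 r0_gt0 r6 rc e S2E; rewrite /region /S_1 S2E; split; first split; nra.
Qed.

Lemma S1_lt_S2_le_Smax c : 0 < c -> 2 * c ^+ 2 <= 1 -> S_1 c < S_2 c <= S_max c.
Proof.
move=> c0 c2; have [r0 [r0_gt0 r6 rc e S2E]] := threshold c0 c2.
have [reg ->] := region_threshold c0 r0_gt0 r6 rc e S2E.
by have [_ /andP[]] := region_bounds c0 reg.
Qed.

Lemma region_violating s c : 0 < c -> 2 * c ^+ 2 <= 1 ->
  S_1 c <= s < S_2 c ->
  exists2 r, region s c r & violating c r.
Proof.
move=> c0 c2 /andP[s1 s2]; have [r0 [r0_gt0 r6 rc e S2E]] := threshold c0 c2.
(* The upper bound on [s] has slope at most 4/3 in [r], so lowering [r0] by 3/4 (S_2 - s), truncated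
   at 0, keeps it above [s]. *)
have [r [r_ge0 rr lo]] : exists r, [/\ 0 <= r, r < r0 & r0 - 3 / 4 * (S_2 c - s) <= r].
  have [neg|pos] := leP (r0 - 3 / 4 * (S_2 c - s)) 0.
    by exists 0.
  by exists (r0 - 3 / 4 * (S_2 c - s)); split; lra.
have lt : 0 < (r0 - r) * (1 - r - r0) by rewrite mulr_gt0 //; lra.
have gap : 0 <= (r0 - r) * (r0 + r) by rewrite mulr_ge0 //; lra.
rewrite /S_1 in s1.
exists r; first by split; lra.
by right; lra.
Qed.

Lemma region_small_entropy s c r : region s c r -> s < S_1 c -> violating c r.
Proof. by rewrite /S_1 => -[_ _ sl _] s1; right; lra. Qed.

Lemma region_large_entropy s c r : 0 < c -> 2 * c ^+ 2 <= 1 ->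
  region s c r -> S_2 c <= s -> ~ violating c r.
Proof.
move=> c0 c2 [r_ge0 rc sl su] s2 [|viol]; first lra.
have [r0 [r0_gt0 r6 rc0 e S2E]] := threshold c0 c2.
have lt : 0 < (r0 - r) * (1 - r - r0) by lra.
have [rr|rr] := ltP r r0.
  (* Below r0 < 1/6 the upper bound increases with [r], so s < S_2. *)
  have : 0 < (r0 - r) * (1 - 3 / 2 * (r0 + r)) by rewrite mulr_gt0 //; lra.
  lra.
(* Violation beyond the other root 1 - r0 is excluded by r <= 1 - c < 1 - r0. *)
have r0c : r0 < c by rewrite -(@ltr_pXn2r _ 2) ?nnegrE ?ltW //; nra.
have : 0 <= (r - r0) * (1 - r - r0) by rewrite mulr_ge0 //; lra.
lra.
Qed.

End Region.

Theorem theorem3p2 (R : realType) :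
  [/\ Lambda_E0 R = Lambda1 R `|` Lambda2 R `|` Lambda3 R,
      Lambda1 R `&` Lambda2 R = set0,
      Lambda1 R `&` Lambda3 R = set0 &
      Lambda2 R `&` Lambda3 R = set0] /\
  [/\ forall s c : R, Lambda1 R (s, c) ->
        forall rho : 'M[R[i]]_(2 * 2), E0 R rho ->
          linear_entropy rho = s -> concurrence rho = c -> VBI rho,
      forall s c : R, Lambda2 R (s, c) ->
        exists rho1 rho2 : 'M[R[i]]_(2 * 2),
          [/\ E0 R rho1, E0 R rho2,
              linear_entropy rho1 = s /\ linear_entropy rho2 = s,
              concurrence rho1 = c /\ concurrence rho2 = c &
              VBI rho1 /\ ~ VBI rho2] &
      forall s c : R, Lambda3 R (s, c) ->
        forall rho : 'M[R[i]]_(2 * 2), E0 R rho ->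
          linear_entropy rho = s -> concurrence rho = c -> ~ VBI rho].
Proof.
have s2V : 0 < (Num.sqrt 2 : R)^-1 by rewrite invr_gt0 sqrtr_gt0.
split; last split.
- split.
  + rewrite eqEsubset; split=> [_ [rho [rhoE rho_c] <-]|[s c] /=].
      have [r reg _] := E0_region rhoE rho_c.
      move: rho_c reg; move: (linear_entropy rho) (concurrence rho) => s c c0 reg.
      have [c1 /andP[s0 sm]] := region_bounds c0 reg.
      have [c2|c2] := leP c (Num.sqrt 2)^-1; last first.
        by left; left; right; rewrite /= c2 c1 s0.
      have [s1|s1] := ltP s (S_1 c).
        by left; left; left; rewrite /= c0 c2 s0.
      have [s2|s2] := ltP s (S_2 c).
        by left; right; rewrite /= c0 c2 s1.
      by right; rewrite /= c0 c2 s2.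
    (* All three sets lie below [S_max], and [region_fill] with [region_E0] realizes every such
       point. *)
    move=> h; suff [c01 sm] : 0 < c <= 1 /\ 0 <= s <= S_max c.
      have [r reg _] := region_fill c01 sm.
      have c0 : 0 < c by case/andP: c01.
      have [rho [rhoE sE cE _]] := region_E0 c0 reg.
      by exists rho; rewrite ?sE ?cE //; split=> //; rewrite cE.
    have S1_ge0 : 0 <= S_1 c by rewrite mulr_ge0 ?sqr_ge0 //; lra.
    have c_le1 : 0 < c -> c <= (Num.sqrt 2)^-1 -> c <= 1.
      move=> c0; rewrite half_sqr_boundsP // => c2.
      by rewrite -(@ler_pXn2r _ 2) ?nnegrE ?(ltW c0) //; lra.
    have Smax_bounds : 0 < c -> c <= (Num.sqrt 2)^-1 -> S_1 c < S_2 c <= S_max c.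
      by move=> c0; rewrite half_sqr_boundsP //; exact: S1_lt_S2_le_Smax.
    case: h => [[[[/andP[c0 c2] /andP[s0 s1]]|[/andP[c2 c1] s01]]|]|].
    * have /andP[s12 s2m] := Smax_bounds c0 c2.
      by rewrite c0 s0 c_le1 //; split=> //; lra.
    * by rewrite c1 s01 (lt_trans s2V).
    * case=> /andP[c0 c2] /andP[s1 s2]; have /andP[s12 s2m] := Smax_bounds c0 c2.
      by rewrite c0 c_le1 //; split=> //; lra.
    * case=> /andP[c0 c2] /andP[s2 sm]; have /andP[s12 s2m] := Smax_bounds c0 c2.
      by rewrite c0 c_le1 //; split=> //; lra.
  + apply/seteqP; split=> // -[s c] [] /=.
    by move=> [[_ /andP[_ s1]]|[/andP[c1 _] _]] [/andP[_ c2] /andP[s2 _]]; lra.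
  + apply/seteqP; split=> // -[s c] [] /=.
    move=> [[_ /andP[_ s1]]|[/andP[c1 _] _]] [/andP[c0 c2] /andP[s2 _]]; last by lra.
    have := S1_lt_S2_le_Smax c0; rewrite -half_sqr_boundsP // => /(_ c2)/andP[s12 _].
    by lra.
  + apply/seteqP; split=> // -[s c] [] /=.
    by move=> [_ /andP[_ s1]] [_ /andP[s2 _]]; lra.
- move=> s c sc rho rhoE sE cE.
  have c0 : 0 < c.
    by case: sc => [[/andP[] //]|[/andP[c2 _] _]]; exact: lt_trans c2.
  rewrite -cE in c0; have [r reg ->] := E0_region rhoE c0.
  rewrite cE sE in reg c0 *.
  case: sc => [[_ /andP[_ s1]]|[/andP[c2 _] _]]; first exact: region_small_entropy reg s1.
  by left; rewrite ltNge -half_sqr_boundsP // -ltNge.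
- move=> s c [/andP[c0 c2] s12].
  have c2' : 2 * c ^+ 2 <= 1 by rewrite -half_sqr_boundsP.
  (* Two values of rho_44 for the same (s, c): [r1] below the threshold, and [r2] from
     [region_fill], not violating since S_1 <= s. *)
  have [r1 reg1 viol1] := region_violating c0 c2' s12.
  have [c1 sm] := region_bounds c0 reg1.
  have /andP[s1 _] := s12.
  have c01 : 0 < c <= 1 by rewrite c0.
  have [r2 reg2 viol2] := region_fill c01 sm.
  have [rho1 [E1 sE1 cE1 v1]] := region_E0 c0 reg1.
  have [rho2 [E2 sE2 cE2 v2]] := region_E0 c0 reg2.
  by exists rho1, rho2; split=> //; split; [exact/v1 | move/v2; exact: viol2].
- move=> s c [/andP[c0 c2] /andP[s2 _]] rho rhoE sE cE.
  rewrite half_sqr_boundsP // in c2.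
  rewrite -cE in c0; have [r reg ->] := E0_region rhoE c0.
  by rewrite cE sE in reg c0 *; exact: region_large_entropy reg s2.
Qed.
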